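(* Let $k$ be a field of characteristic zero, let $A := k[X_1,\ldots,X_n]$ be the polynomial ring in $n$ variables ($n \geq 1$) over $k$, and let $\mathfrak{p}$ be a prime ideal of $A$. Let $\Delta$ be a lower saturated subset of $\mathbb{R}_{\geq 0}^n$ and let $\Sigma := \Delta \cap \mathbb{Z}_{\geq 0}^n$. Let $\mathfrak{I}$ be an ideal of $A$ such that $\mathfrak{p}$ is a minimal prime of $\mathfrak{I}$ and $\partial^{\gamma}(\mathfrak{I}) \subseteq \mathfrak{p}$ for all $\gamma \in \Sigma$. Then \[ \operatorname{length}_{A_{\mathfrak{p}}}\bigl((A/\mathfrak{I})_{\mathfrak{p}}\bigr) \geq \operatorname{vol}_{(\mathbb{R}^n)_\Upsilon}(\Delta_\Upsilon), \] where $\operatorname{vol}_{(\mathbb{R}^n)_\Upsilon}(\Delta_\Upsilon)$ is the volume of $\Delta_\Upsilon$ in $(\mathbb{R}^n)_\Upsilon$.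
   Context: A subset $\Delta$ of $\mathbb{R}_{\geq 0}^n$ is called lower saturated if it is non-empty and $[0,\xi_1]\times\cdots\times[0,\xi_n] \subseteq \Delta$ for all $(\xi_1,\ldots,\xi_n)\in\Delta$. For $i=1,\ldots,n$ let $x_i$ be the image of $X_i$ in $A/\mathfrak{p}$. Inside the fraction field of $A/\mathfrak{p}$ put $K_i := k(x_i,\ldots,x_n)$ for $i=1,\ldots,n$ and $K_{n+1} := k$. Define $\Upsilon := \{ i \in \{1,\ldots,n\} \mid K_i \text{ is algebraic over } K_{i+1}\}$. Put $(\mathbb{R}^n)_\Upsilon := \{(\xi_1,\ldots,\xi_n)\in\mathbb{R}^n \mid \xi_j = 0 \text{ for all } j\notin\Upsilon\} \cong \mathbb{R}^\Upsilon$ and $\Delta_\Upsilon := \Delta\cap(\mathbb{R}^n)_\Upsilon$. Volume in $(\mathbb{R}^n)_\Upsilon$ means Lebesgue measure under the coordinate identification with $\mathbb{R}^\Upsilon$ (when $\Upsilon=\emptyset$, the one-point space has volume $1$). For $\gamma=(e_1,\ldots,e_n)\in\mathbb{Z}_{\geq 0}^n$, $\partial^\gamma := \partial^{e_1+\cdots+e_n}/\partial X_1^{e_1}\cdots\partial X_n^{e_n}$ acting on $A$, and $\partial^\gamma(\mathfrak{I}) := \{\partial^\gamma(f) \mid f\in\mathfrak{I}\}$. *)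

(* Defs.v *)
From HB Require Import structures.
From mathcomp Require Import all_boot all_algebra.
From mathcomp Require Import -(notations) mpoly.
From mathcomp Require Import ring.
From mathcomp Require Import all_classical all_reals all_analysis.

Set Implicit Arguments.
Unset Strict Implicit.
Unset Printing Implicit Defensive.

Import GRing.Theory Num.Theory.
Local Open Scope ring_scope.
Local Open Scope classical_set_scope.
Local Open Scope quotient_scope.

(* Importing all the notations of mpoly clashes with those of analysis. *)
Notation "{ 'mpoly' T [ n ] }" := (mpoly n T)
  (format "{ 'mpoly'  T [ n ] }") : type_scope.

(* An idealr is a proper ideal given by a boolean predicate; the classical
   axioms make every proper ideal of A one.  Here A/I is made an A-module. *)
Section IdealQuotient.
Variables (A : comNzRingType) (I : idealr A).
Local Notation AI := {ideal_quot I}.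

Definition quot_scale (a : A) (x : AI) : AI := \pi_AI a * x.

Fact quot_scaleA a b x : quot_scale a (quot_scale b x) = quot_scale (a * b) x.
Proof. by rewrite /quot_scale rmorphM mulrA. Qed.

Fact quot_scale1 : left_id 1 quot_scale.
Proof. by move=> x; rewrite /quot_scale rmorph1 mul1r. Qed.

Fact quot_scaleDr : right_distributive quot_scale +%R.
Proof. by move=> a x y; rewrite /quot_scale mulrDr. Qed.

Fact quot_scaleDl x : {morph quot_scale^~ x : a b / a + b}.
Proof. by move=> a b; rewrite /quot_scale rmorphD mulrDl. Qed.

HB.instance Definition _ := GRing.Zmodule_isLmodule.Build A (Quotient.quot I)
  quot_scaleA quot_scale1 quot_scaleDr quot_scaleDl.

End IdealQuotient.

Section PrimeQuotient.
Variables (A : comNzRingType) (p : prime_idealr A).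
Local Notation Ap := {ideal_quot p}.

Definition quot_unit : pred Ap := fun x => `[< exists y, y * x = 1 >].

Definition quot_inv (x : Ap) : Ap :=
  if pselect (exists y, y * x = 1) is left xV then sval (cid xV) else x.

Fact quot_mulVr : {in quot_unit, left_inverse 1 quot_inv *%R}.
Proof.
move=> x /asboolP xV; rewrite /quot_inv; case: pselect => // xV'.
by case: (cid xV').
Qed.

Fact quot_unitPl x y : y * x = 1 -> quot_unit x.
Proof. by move=> yx; apply/asboolP; exists y. Qed.

Fact quot_inv_out : {in [predC quot_unit], quot_inv =1 id}.
Proof.
by move=> x /asboolPn xNV; rewrite /quot_inv; case: pselect.
Qed.

HB.instance Definition _ := GRing.ComNzRing_hasMulInverse.Build
  (Quotient.quot p) quot_mulVr quot_unitPl quot_inv_out.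

HB.instance Definition _ := GRing.ComUnitRing_isIntegral.Build
  (Quotient.quot p) (@Quotient.rquot_IdomainAxiom A p).

End PrimeQuotient.

(* The localization M_p of an A-module M, as a module over the ring A_p, by
   fractions m / s with s outside p, where m / s = n / t if and only if
   u (t m) = u (s n) for some u outside p. *)
Section Localization.
Variables (A : comNzRingType) (p : prime_idealr A).

Record denom := Denom { den : A; denP : den \notin p }.
HB.instance Definition _ := [isSub for den].
HB.instance Definition _ := [Choice of denom by <:].

Fact denom1_subproof : 1 \notin p.
Proof. by rewrite idealr1. Qed.

Definition denom1 : denom := Denom denom1_subproof.

Fact denom_mul_subproof (s t : denom) : den s * den t \notin p.
Proof. by rewrite prime_idealrM negb_or (denP s) (denP t). Qed.

Definition denom_mul (s t : denom) : denom :=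
  Denom (denom_mul_subproof s t).

Section Module.
Variable M : lmodType A.
Implicit Types (m : M) (s t u : denom).

Definition loc_equiv (x y : M * denom) : bool :=
  `[< exists u : denom,
        den u *: (den y.2 *: x.1) = den u *: (den x.2 *: y.1) >].

Fact loc_equiv_is_equiv : equiv_class_of loc_equiv.
Proof.
split=> [x|x y|y x z].
- by apply/asboolP; exists denom1.
- by apply/asboolP/asboolP => -[u uE]; exists u.
- move=> /asboolP[u uE] /asboolP[v vE]; apply/asboolP.
  exists (denom_mul (denom_mul u v) y.2); move: uE vE; rewrite /= !scalerA.
  move=> uE vE.
  rewrite (_ : _ * _ = den v * den z.2 * (den u * den y.2)); last by ring.
  rewrite -scalerA uE scalerA.
  rewrite (_ : _ * _ = den u * den x.2 * (den v * den z.2)); last by ring.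
  by rewrite -scalerA vE scalerA; congr (_ *: _); ring.
Qed.

Canonical loc_equiv_equiv := EquivRelPack loc_equiv_is_equiv.
Canonical loc_equiv_encModRel := defaultEncModRel loc_equiv.

Definition loc_mod : Type := {eq_quot loc_equiv}.
HB.instance Definition _ := EqQuotient.on loc_mod.
HB.instance Definition _ := Choice.on loc_mod.

Definition loc_frac m s : loc_mod := \pi_loc_mod (m, s).

Lemma loc_fracP m s n t :
  loc_frac m s = loc_frac n t <->
  exists u : denom, den u *: (den t *: m) = den u *: (den s *: n).
Proof.
split=> [/eqmodP/asboolP[u uE]|[u uE]]; first by exists u.
by apply/eqmodP/asboolP; exists u.
Qed.

Lemma loc_fracE m s n t : den t *: m = den s *: n -> loc_frac m s = loc_frac n t.
Proof. by move=> E; apply/loc_fracP; exists denom1; rewrite E. Qed.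

Variant loc_spec : loc_mod -> Prop := LocSpec m s : loc_spec (loc_frac m s).

Lemma locP x : loc_spec x.
Proof. by rewrite -[x]reprK; case: (repr x) => m s; exact: LocSpec. Qed.

Definition loc_zero : loc_mod := loc_frac 0 denom1.

Definition loc_opp (x : loc_mod) : loc_mod :=
  loc_frac (- (repr x).1) (repr x).2.

Definition loc_add (x y : loc_mod) : loc_mod :=
  loc_frac (den (repr y).2 *: (repr x).1 + den (repr x).2 *: (repr y).1)
           (denom_mul (repr x).2 (repr y).2).

Lemma loc_frac_repr (x : loc_mod) : loc_frac (repr x).1 (repr x).2 = x.
Proof. by rewrite /loc_frac -surjective_pairing reprK. Qed.

Lemma loc_oppE m s : loc_opp (loc_frac m s) = loc_frac (- m) s.
Proof.
have /loc_fracP[u uE] := loc_frac_repr (loc_frac m s).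
by apply/loc_fracP; exists u; rewrite !scalerN uE.
Qed.

Lemma loc_addE m s n t : loc_add (loc_frac m s) (loc_frac n t) =
  loc_frac (den t *: m + den s *: n) (denom_mul s t).
Proof.
rewrite /loc_add.
move: (loc_frac_repr (loc_frac m s)) (loc_frac_repr (loc_frac n t)).
case: (repr (loc_frac m s)) => m' s'; case: (repr (loc_frac n t)) => n' t' /=.
move=> /loc_fracP[u uE] /loc_fracP[v vE].
apply/loc_fracP; exists (denom_mul u v); move: uE vE.
rewrite /= !scalerDr !scalerA => uE vE; congr (_ + _).
- rewrite (_ : _ * _ = den v * den t * den t' * (den u * den s)); last by ring.
  by rewrite -scalerA uE scalerA; congr (_ *: _); ring.
- rewrite (_ : _ * _ = den u * den s * den s' * (den v * den t)); last by ring.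
  by rewrite -scalerA vE scalerA; congr (_ *: _); ring.
Qed.

Fact loc_addA : associative loc_add.
Proof.
move=> x y z; case: (locP x) => m s; case: (locP y) => n t; case: (locP z) => q w.
rewrite !loc_addE; apply: loc_fracE; rewrite /= !scalerDr !scalerA addrA.
by congr (_ + _ + _); congr (_ *: _); ring.
Qed.

Fact loc_addC : commutative loc_add.
Proof.
move=> x y; case: (locP x) => m s; case: (locP y) => n t.
by rewrite !loc_addE addrC; apply: loc_fracE; rewrite /= mulrC.
Qed.

Fact loc_add0 : left_id loc_zero loc_add.
Proof.
move=> x; case: (locP x) => m s; rewrite loc_addE; apply: loc_fracE.
by rewrite /= scaler0 add0r scale1r mul1r.
Qed.

Fact loc_addN : left_inverse loc_zero loc_opp loc_add.
Proof.
move=> x; case: (locP x) => m s; rewrite loc_oppE loc_addE; apply: loc_fracE.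
by rewrite /= scalerN addNr !scaler0.
Qed.

HB.instance Definition _ :=
  GRing.isZmodule.Build loc_mod loc_addA loc_addC loc_add0 loc_addN.

Lemma loc_fracD m s n t : loc_frac m s + loc_frac n t =
  loc_frac (den t *: m + den s *: n) (denom_mul s t).
Proof. exact: loc_addE. Qed.

Lemma loc_fracN m s : - loc_frac m s = loc_frac (- m) s.
Proof. exact: loc_oppE. Qed.

Lemma loc_frac0 s : loc_frac 0 s = 0.
Proof. by apply: loc_fracE; rewrite !scaler0. Qed.

End Module.

Definition loc_ring : Type := loc_mod A^o.
HB.instance Definition _ := GRing.Zmodule.on loc_ring.

Definition loc_scale (M : lmodType A) (a : loc_ring) (x : loc_mod M) :
    loc_mod M :=
  loc_frac ((repr a).1 *: (repr x).1) (denom_mul (repr a).2 (repr x).2).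

Lemma loc_scaleE (M : lmodType A) (a : A) s (m : M) t :
  loc_scale (loc_frac (a : A^o) s) (loc_frac m t) =
  loc_frac (a *: m) (denom_mul s t).
Proof.
rewrite /loc_scale.
move: (loc_frac_repr (loc_frac (a : A^o) s)) (loc_frac_repr (loc_frac m t)).
case: (repr (loc_frac (a : A^o) s)) => a' s'.
case: (repr (loc_frac m t)) => m' t' /=.
move=> /loc_fracP[u uE] /loc_fracP[v vE].
have {}uE : den u * (den s * a') = den u * (den s' * a) := uE.
apply/loc_fracP; exists (denom_mul u v); move: vE.
rewrite /= !scalerA => vE.
rewrite (_ : _ * a' = den u * (den s * a') * (den v * den t)); last by ring.
by rewrite -scalerA vE scalerA uE; congr (_ *: _); ring.
Qed.

Definition loc_one : loc_ring := loc_frac (1 : A^o) denom1.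
Definition loc_mul (x y : loc_ring) : loc_ring := loc_scale x y.

Lemma loc_mulE (a b : A) s t :
  loc_mul (loc_frac (a : A^o) s) (loc_frac (b : A^o) t) =
  loc_frac (a * b : A^o) (denom_mul s t).
Proof. exact: loc_scaleE. Qed.

Lemma loc_ringE (a b : A) s t : den t * a = den s * b ->
  loc_frac (a : A^o) s = loc_frac (b : A^o) t :> loc_ring.
Proof. by move=> E; exact: loc_fracE. Qed.

Lemma loc_ringD (a b : A) s t :
  loc_frac (a : A^o) s + loc_frac (b : A^o) t =
  loc_frac (den t * a + den s * b : A^o) (denom_mul s t) :> loc_ring.
Proof. exact: loc_fracD. Qed.

Variant loc_ring_spec : loc_ring -> Prop :=
  LocRingSpec (a : A) s : loc_ring_spec (loc_frac (a : A^o) s).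

Lemma loc_ringP (x : loc_ring) : loc_ring_spec x.
Proof. by case: (locP x) => a s; exact: LocRingSpec. Qed.

Fact loc_mulA : associative loc_mul.
Proof.
move=> x y z; case: (loc_ringP x) => a s; case: (loc_ringP y) => b t.
case: (loc_ringP z) => c w.
by rewrite !loc_mulE; apply: loc_ringE => /=; ring.
Qed.

Fact loc_mulC : commutative loc_mul.
Proof.
move=> x y; case: (loc_ringP x) => a s; case: (loc_ringP y) => b t.
by rewrite !loc_mulE; apply: loc_ringE => /=; ring.
Qed.

Fact loc_mul1 : left_id loc_one loc_mul.
Proof.
move=> x; case: (loc_ringP x) => a s.
by rewrite loc_mulE; apply: loc_ringE => /=; ring.
Qed.

Fact loc_mulDl : left_distributive loc_mul (@GRing.add loc_ring).
Proof.
move=> x y z; case: (loc_ringP x) => a s; case: (loc_ringP y) => b t.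
case: (loc_ringP z) => c w.
by rewrite loc_ringD !loc_mulE loc_ringD; apply: loc_ringE => /=; ring.
Qed.

Fact loc_one_neq0 : loc_one != 0.
Proof.
apply/eqP => /loc_fracP[u uE].
have {}uE : den u * (1 * 1) = den u * (1 * 0) := uE.
by have := denP u; rewrite -[den u]mulr1 -[1]mulr1 uE !mulr0 rpred0.
Qed.

HB.instance Definition _ := GRing.Zmodule_isComNzRing.Build loc_ring
  loc_mulA loc_mulC loc_mul1 loc_mulDl loc_one_neq0.

Section Scale.
Variable M : lmodType A.

Fact loc_scaleA (a b : loc_ring) (x : loc_mod M) :
  loc_scale a (loc_scale b x) = loc_scale (a * b) x.
Proof.
case: (loc_ringP a) => {}a s; case: (loc_ringP b) => {}b t; case: (locP x) => m w.
rewrite [_ * _]loc_mulE !loc_scaleE; apply: loc_fracE; rewrite /= !scalerA.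
by congr (_ *: _); ring.
Qed.

Fact loc_scale1 : left_id (1 : loc_ring) (@loc_scale M).
Proof.
move=> x; case: (locP x) => m w.
by rewrite loc_scaleE; apply: loc_fracE; rewrite /= scale1r mul1r.
Qed.

Fact loc_scaleDr : right_distributive (@loc_scale M) +%R.
Proof.
move=> a x y; case: (loc_ringP a) => {}a s; case: (locP x) => m t; case: (locP y) => n w.
rewrite loc_fracD !loc_scaleE loc_fracD; apply: loc_fracE.
by rewrite /= !scalerDr !scalerA; congr (_ *: _ + _ *: _); ring.
Qed.

Fact loc_scaleDl (x : loc_mod M) : {morph (@loc_scale M)^~ x : a b / a + b}.
Proof.
move=> a b; case: (loc_ringP a) => {}a s; case: (loc_ringP b) => {}b t; case: (locP x) => m w.
rewrite loc_ringD !loc_scaleE loc_fracD; apply: loc_fracE.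
by rewrite /= !scalerDr !scalerA -scalerDl; congr (_ *: _); ring.
Qed.

HB.instance Definition _ := GRing.Zmodule_isLmodule.Build loc_ring (loc_mod M)
  loc_scaleA loc_scale1 loc_scaleDr loc_scaleDl.

End Scale.

End Localization.

(* Supremum of the lengths m of the chains N_0 < ... < N_m of submodules. *)
Definition module_length (R : realType) (B : nzRingType) (V : lmodType B) :
    \bar R :=
  ereal_sup [set m%:R%:E | m in [set m : nat |
    exists N : nat -> submodClosed V, forall i, (i < m)%N ->
      {subset N i <= N i.+1} /\ ~ {subset N i.+1 <= N i}]].
Arguments module_length R B V : clear implicits.

Definition minimal_prime (A : comNzRingType) (I : idealr A)
    (p : prime_idealr A) : Prop :=
  {subset I <= p} /\
  forall q : prime_idealr A,
    {subset I <= q} -> {subset q <= p} -> {subset p <= q}.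

(* Lebesgue measure on R^m, as the m-fold product of the measure on R.  Like
   lebesgue_measure itself it lives on the Borel sets. *)
Section LebesgueTuple.
Variable R : realType.
Local Notation tupleR m := (m.-tuple (measurableTypeR R)).

Definition tuple_cons m (x : measurableTypeR R * tupleR m) : tupleR m.+1 :=
  [tuple of x.1 :: x.2].

Definition tuple_uncons m (t : tupleR m.+1) : measurableTypeR R * tupleR m :=
  (thead t, [tuple of behead t]).

Fact tuple_consK m : cancel (@tuple_cons m) (@tuple_uncons m).
Proof. by case=> a t; congr pair; exact/val_inj. Qed.

Fact tuple_unconsK m : cancel (@tuple_uncons m) (@tuple_cons m).
Proof. by move=> t; rewrite [RHS]tuple_eta. Qed.

Fact measurable_tuple_cons m : measurable_fun setT (@tuple_cons m).
Proof. exact: measurable_cons. Qed.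

Fact measurable_tuple_uncons m : measurable_fun setT (@tuple_uncons m).
Proof.
by apply/measurable_fun_pair; [exact: measurable_tnth|exact: measurable_behead].
Qed.

Section Cons.
Variables (m : nat) (mu : {sigma_finite_measure set (tupleR m) -> \bar R}).
Local Notation nu := (product_measure1 (@lebesgue_measure R) mu).

Definition lebesgue_cons : set (tupleR m.+1) -> \bar R :=
  pushforward nu (@tuple_cons m).

Let lebesgue_cons0 : lebesgue_cons set0 = 0%E.
Proof. by rewrite /lebesgue_cons /pushforward preimage_set0 measure0. Qed.

Let measurable_preimage_cons X :
  measurable X -> measurable (@tuple_cons m @^-1` X).
Proof.
by move=> mX; rewrite -[X in measurable X]setTI; exact: measurable_tuple_cons.
Qed.

Let lebesgue_cons_ge0 X : (0 <= lebesgue_cons X)%E.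
Proof. exact: (measure_ge0 nu). Qed.

Let lebesgue_cons_sigma_additive : semi_sigma_additive lebesgue_cons.
Proof.
move=> F mF tF mUF; rewrite /lebesgue_cons /pushforward preimage_bigcup.
apply: (@measure_semi_sigma_additive _ _ _ nu) => [k||].
- exact: measurable_preimage_cons.
- apply/trivIsetP => i j _ _ ij; rewrite -preimage_setI.
  by move/trivIsetP : tF => /(_ _ _ _ _ ij) -> //; rewrite preimage_set0.
- by rewrite -preimage_bigcup; exact: measurable_preimage_cons.
Qed.

HB.instance Definition _ := isMeasure.Build _ _ _ lebesgue_cons
  lebesgue_cons0 lebesgue_cons_ge0 lebesgue_cons_sigma_additive.

Let lebesgue_cons_sigma_finite : sigma_finite setT lebesgue_cons.
Proof.
have /sigma_finiteP[F [TF ndF Foo]] := sigma_finiteT (@lebesgue_measure R).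
have /sigma_finiteP[G [TG ndG Goo]] := sigma_finiteT mu.
exists (fun k => @tuple_uncons m @^-1` (F k `*` G k)).
  apply/esym/seteqP; split=> // t _.
  have : [set: measurableTypeR R] (thead t) by [].
  have : [set: tupleR m] [tuple of behead t] by [].
  rewrite TF TG => -[l _ Gl] [k _ Fk]; exists (maxn k l) => //; split.
  - by move: Fk; exact/subsetPset/ndF/leq_maxl.
  - by move: Gl; exact/subsetPset/ndG/leq_maxr.
move=> k; have [mF Fk] := Foo k; have [mG Gk] := Goo k.
have mFG : measurable (F k `*` G k) by exact: measurableX.
split; first by rewrite -[X in measurable X]setTI; exact: measurable_tuple_uncons.
rewrite /lebesgue_cons /pushforward -comp_preimage.
rewrite (_ : _ \o _ = id); last by apply/funext => x /=; exact: tuple_consK.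
rewrite preimage_id product_measure1E //.
by rewrite lte_mul_pinfty // ge0_fin_numE.
Qed.

HB.instance Definition _ := Measure_isSigmaFinite.Build _ _ _ lebesgue_cons
  lebesgue_cons_sigma_finite.

End Cons.

Fixpoint lebesgue_tuple m : {sigma_finite_measure set (tupleR m) -> \bar R} :=
  if m is m'.+1 then lebesgue_cons (lebesgue_tuple m')
  else \d_([tuple] : tupleR 0).

End LebesgueTuple.

Section Volume.
Variables (R : realType) (n : nat).

Definition lower_saturated (Delta : set 'rV[R]_n) : Prop :=
  [/\ Delta `<=` [set xi | forall i, 0 <= xi 0 i],
      Delta !=set0 &
      forall xi, Delta xi ->
        [set eta : 'rV[R]_n | forall i, 0 <= eta 0 i <= xi 0 i] `<=` Delta].

Definition nat_point (gamma : multinom n) : 'rV[R]_n := \row_i (gamma i)%:R.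

Variable J : {set 'I_n}.

Definition coord_subspace : set 'rV[R]_n :=
  [set xi | forall j, j \notin J -> xi 0 j = 0].

Definition coord_proj (xi : 'rV[R]_n) : #|J|.-tuple (measurableTypeR R) :=
  [tuple xi 0 (enum_val i) | i < #|J|].

(* For S contained in coord_subspace.  The outer extension of the measure
   is used because a lower saturated set is Lebesgue measurable but may fail
   to be Borel. *)
Definition coord_volume (S : set 'rV[R]_n) : \bar R :=
  mu_ext (lebesgue_tuple R #|J|) (coord_proj @` S).

End Volume.

Definition algebraic_over (L : fieldType) (E F : set L) : Prop :=
  forall z, F z -> exists q : {poly L},
    [/\ q != 0, forall i, E q`_i & root q z].

Section Upsilon.
Variables (k : fieldType) (n : nat) (p : prime_idealr {mpoly k[n]}).
Local Notation L := {fraction {ideal_quot p}}.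

Definition residue (f : {mpoly k[n]}) : L :=
  FracField.tofrac (\pi_{ideal_quot p} f).

(* The subfield generated by k and by the x_j with j >= i; the variables are
   numbered from 0, so that tail_field n is the image of k. *)
Definition tail_field (i : nat) : set L :=
  smallest (fun F : set L => GRing.divring_closed (mem F))
    ([set residue (mpolyC n c) | c in [set: k]] `|`
     [set residue (mpolyX k (mnm1 j)) | j in [set j : 'I_n | (i <= j)%N]]).

Definition Upsilon : {set 'I_n} :=
  [set i : 'I_n | `[< algebraic_over (tail_field i.+1) (tail_field i) >]]%SET.

End Upsilon.
Arguments tail_field {k n} p i.

(* Main.v *)
Require Import Defs.
From HB Require Import structures.
From mathcomp Require Import all_boot all_order all_algebra.
From mathcomp Require Import -(notations) mpoly.
From mathcomp Require Import all_classical all_reals all_analysis.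

(** Let A = k[X_0, ..., X_(n-1)], let D = A/p, and let x be the generic point
    of p, that is, the point of D^n whose coordinates are the images of the
    variables.  Taylor expansion at x is the ring morphism T from A to
    D[Y_0, ..., Y_(n-1)] sending f to f(x + Y).  In characteristic zero the
    coefficient of Y^m in T f vanishes exactly when the derivative of f of
    order m lies in p ([mcoeff_taylor_eq0]).
    With Sigma the set of the points of Delta with natural coordinates, the
    hypothesis on I thus says that T f has no monomial in Sigma when f is in I.

    Give Y_i the weight n + i.  As i < n, every monomial of degree at least 2
    weighs more than each of the variables, and Y_j weighs more than Y_i when
    j > i.  For i in Upsilon, a polynomial relation for x_i over
    k[x_(i+1), ..., x_(n-1)] of least degree is separable; it yields an f_i in
    k[X_i, ..., X_(n-1)] such that f_i is in p and its i-th partial derivative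
    is not.  So Y_i is the only monomial of least weight in T f_i
    ([lowest_taylor_Upsilon]), and Y^m is the only monomial of least weight in T
    of the product of the f_i^(m_i) when m is supported on Upsilon
    ([lowest_prod]).

    Now let m_0, ..., m_(r-1) be distinct points of Sigma supported on Upsilon,
    sorted by weight.  The polynomials f such that T f has no monomial dividing
    one of Y^(m_0), ..., Y^(m_(j-1)) form an ideal containing I; it contains the
    product attached to m_j, which is not in the next such ideal, even after
    localization at p.  This gives a chain of r strict inclusions of submodules
    of (A/I)_p ([module_length_ge]).

    Finally Delta is lower saturated, so the unit cubes whose lower corners are
    the points of Sigma supported on Upsilon cover the part of Delta in the
    coordinate subspace of Upsilon, whence the volume is at most the number of
    those points ([coord_volume_le]). *)

Set Implicit Arguments.
Unset Strict Implicit.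
Unset Printing Implicit Defensive.

Import Order.TTheory GRing.Theory Num.Theory.
Local Open Scope ring_scope.
Local Open Scope classical_set_scope.
Local Open Scope quotient_scope.

(** * Taylor expansion at a point *)

Section Taylor.
Variables (k : fieldType) (n : nat) (D : idomainType).
Variable phi : {rmorphism {mpoly k[n]} -> D}.
Implicit Types (f g : {mpoly k[n]}) (m : multinom n).

(** A property of polynomials stable under sums and products holds everywhere
    as soon as it holds for the constants and the variables. *)
Lemma mpoly_ringind (P : {mpoly k[n]} -> Prop) :
  (forall c, P (mpolyC n c)) -> (forall i, P (mpolyX k (mnm1 i))) ->
  (forall f g, P f -> P g -> P (f + g)) ->
  (forall f g, P f -> P g -> P (f * g)) -> forall f, P f.
Proof.
move=> PC PX PD PM; elim/mpolyind => [|c m f _ _ Pf].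
  by rewrite -[0](@mpolyC0 n); exact: PC.
apply: (PD) => //; rewrite -mul_mpolyC; apply: (PM); first exact: PC.
rewrite mpolyXE_id; apply: big_ind => [|//|i _]; first exact: (PC 1).
by elim: (m i) => [|e IHe]; [exact: (PC 1)|rewrite exprS; exact: PM].
Qed.

(** The expansion of f(x + Y) in powers of Y, where x is the point of D^n given
    by the values of phi at the variables; phi is also applied to the
    coefficients of f. *)
Definition taylor : {mpoly k[n]} -> {mpoly D[n]} :=
  mmap (@mpolyC n D \o phi \o @mpolyC n k)
       (fun i => mpolyC n (phi (mpolyX k (mnm1 i))) + mpolyX D (mnm1 i)).

HB.instance Definition _ := GRing.RMorphism.on taylor.

Lemma taylorC c : taylor (mpolyC n c) = mpolyC n (phi (mpolyC n c)).
Proof. exact: mmapC. Qed.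

Lemma taylorX i : taylor (mpolyX k (mnm1 i)) =
  mpolyC n (phi (mpolyX k (mnm1 i))) + mpolyX D (mnm1 i).
Proof. by rewrite /taylor mmapX mmap1U. Qed.

Lemma taylor_mderiv i f : taylor (mderiv i f) = mderiv i (taylor f).
Proof.
elim/mpoly_ringind: f => [c|j|f g fE gE|f g fE gE].
- by rewrite mderivC taylorC mderivC rmorph0.
- rewrite taylorX mderivD mderivC add0r !mderivX !mnm1E.
  rewrite -!mul_mpolyC rmorphM /=.
  rewrite taylorC !rmorph_nat; case: eqP => [->|_]; last by rewrite !mul0r.
  have -> : mnm_sub (mnm1 i) (mnm1 i) = mnm0 :> multinom n.
    by apply/mnmP => l; rewrite mnmBE mnm0E subnn.
  by rewrite !mpolyX0 !rmorph1.
- by rewrite !raddfD /= fE gE.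
- by rewrite mderivM !(rmorphD, rmorphM) /= mderivM fE gE.
Qed.

Lemma taylor_mderivm m f : taylor (mderivm m f) = mderivm m (taylor f).
Proof.
rewrite !mderivm_foldr; elim: (flatten _) => //= i s IHs.
by rewrite taylor_mderiv IHs.
Qed.

Lemma mcoeff0_taylor f : mcoeff mnm0 (taylor f) = phi f.
Proof.
elim/mpoly_ringind: f => [c|j|f g fE gE|f g fE gE].
- by rewrite taylorC mcoeffC eqxx mulr1.
- by rewrite taylorX mcoeffD mcoeffC eqxx mulr1 mcoeffX mnm1_eq0 addr0.
- by rewrite !raddfD /= fE gE.
- by rewrite !rmorphM /= fE gE.
Qed.

(** Taylor's formula: m! times the coefficient of Y^m is the value at x of the
    derivative of order m. *)
Lemma mcoeff_taylor m f :
  mcoeff m (taylor f) *+ (\prod_(i < n) (m i)`!) = phi (mderivm m f).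
Proof.
rewrite -mcoeff0_taylor taylor_mderivm mcoeff_mderivm addm0.
by congr (_ *+ _); apply: eq_bigr => i _; rewrite ffactnn.
Qed.

Hypothesis char0 : [pchar k] =i pred0.

Lemma natr_phi_neq0 e : (0 < e)%N -> e%:R != 0 :> D.
Proof.
move=> e0; rewrite -(rmorph_nat phi) -(rmorph_nat (@mpolyC n k)).
have : (e%:R : k) != 0 by have /pcharf0P -> := char0; rewrite -lt0n.
move=> eN0; apply/eqP => eE0.
have /eqP : phi (mpolyC n ((e%:R : k)^-1 * e%:R)) = 0.
  by rewrite rmorphM /= rmorphM /= eE0 mulr0.
by rewrite mulVf// !rmorph1 oner_eq0.
Qed.

Lemma mcoeff_taylor_eq0 m f :
  mcoeff m (taylor f) = 0 <-> phi (mderivm m f) = 0.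
Proof.
rewrite -mcoeff_taylor -mulr_natr; split=> [->|/eqP]; first by rewrite mul0r.
rewrite mulf_eq0 (negPf (natr_phi_neq0 _)) ?orbF => [/eqP//|].
by rewrite prodn_gt0// => i; exact: fact_gt0.
Qed.

End Taylor.

(** * Monomials of least weight *)

Section MultinomWeight.
Variable n : nat.
Implicit Types (m d : multinom n) (i j : 'I_n).

(** The weight of the variable of index i is n + i, with 0 <= i < n; the weights
    increase with i, and each is less than the sum of any two of them. *)
Definition weight m : nat := (\sum_(i < n) (n + i) * m i)%N.

Lemma weightD m d : weight (mnm_add m d) = (weight m + weight d)%N.
Proof.
by rewrite /weight -big_split; apply: eq_bigr => i _; rewrite mnmDE mulnDr.
Qed.

Lemma weight1 i : weight (mnm1 i) = (n + i)%N.
Proof.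
rewrite /weight (bigD1 i)//= mnm1E eqxx muln1 big1 ?addn0// => j ji.
by rewrite mnm1E eq_sym (negPf ji) muln0.
Qed.

Lemma leq_weight m d : mpoly.lem m d -> (weight m <= weight d)%N.
Proof. by move=> /submK <-; rewrite weightD leq_addl. Qed.

Lemma leq_mdeg_weight m : (n * mdeg m <= weight m)%N.
Proof.
rewrite mdegE big_distrr/=; apply: leq_sum => i _.
by rewrite leq_mul2r leq_addr orbT.
Qed.

Lemma weight_eq0 m : weight m = 0%N -> m = mnm0.
Proof.
move=> m0; apply/eqP; rewrite -mdeg_eq0 -leqn0; case: (posnP n) => [n0|n_gt0].
  by rewrite mdegE big1// => i; have := ltn_ord i; rewrite [leqRHS]n0.
by rewrite -(leq_pmul2l n_gt0) muln0 -m0 leq_mdeg_weight.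
Qed.

Lemma lem_weight_eq m d : mpoly.lem m d -> (weight d <= weight m)%N -> d = m.
Proof.
move=> md; rewrite -{1}(submK md) weightD -[leqRHS]add0n leq_add2r leqn0.
by move=> /eqP/weight_eq0 dm; rewrite -(submK md) dm add0m.
Qed.

(** Only the constant monomial and the variables of index at most i weigh no
    more than the variable of index i: a monomial of degree at least 2 has
    weight at least 2n. *)
Lemma leq_weight1 m i : (weight m <= n + i)%N ->
  m = mnm0 \/ exists2 j, m = mnm1 j & (j <= i)%N.
Proof.
move=> mi; have [m2|] := ltnP 1 (mdeg m).
  have /leq_trans/(_ mi) : (n * 2 <= weight m)%N.
    by rewrite (leq_trans _ (leq_mdeg_weight m))// leq_mul2l m2 orbT.
  by rewrite muln2 -addnn leq_add2l leqNgt ltn_ord.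
rewrite leq_eqVlt ltnS leqn0 mdeg_eq0 mdeg_eq1 => /orP[|/eqP]; last by left.
move=> /existsP[j /eqP mj]; right; exists j => //.
by move: mi; rewrite mj weight1 leq_add2l.
Qed.

End MultinomWeight.

Section LowestMonomial.
Variables (n : nat) (D : idomainType).
Implicit Types (m d : multinom n) (P Q : {mpoly D[n]}).

Lemma mcoeffM_eq0 P Q m :
  (forall m1 m2, m = mnm_add m1 m2 -> mcoeff m1 P * mcoeff m2 Q = 0) ->
  mcoeff m (P * Q) = 0.
Proof. by move=> PQ0; rewrite mcoeffM big1// => -[k1 k2] /= /eqP/PQ0. Qed.

(** The coefficient of a product at the sum of m1 and m2, when no other
    decomposition of this sum contributes. *)
Lemma mcoeffM_uniq P Q m1 m2 :
  (forall d1 d2, mnm_add m1 m2 = mnm_add d1 d2 -> d1 != m1 ->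
    mcoeff d1 P * mcoeff d2 Q = 0) ->
  mcoeff (mnm_add m1 m2) (P * Q) = mcoeff m1 P * mcoeff m2 Q.
Proof.
move=> PQ0; rewrite mcoeffM.
have lt1 : (mdeg m1 < (mdeg (mnm_add m1 m2)).+1)%N.
  by rewrite ltnS mdegD leq_addr.
have lt2 : (mdeg m2 < (mdeg (mnm_add m1 m2)).+1)%N.
  by rewrite ltnS mdegD leq_addl.
rewrite (bigD1 (BMultinom lt1, BMultinom lt2)) ?eqxx//= big1 ?addr0//.
move=> [k1 k2] /andP[/eqP /= mk kN]; apply: PQ0 => //.
apply: contra kN => /eqP k1E.
apply/eqP; congr pair; apply: val_inj => //=.
by move: mk; rewrite k1E => /addmI.
Qed.

(** The monomial m occurs in P, and all the other monomials of P have a strictly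
    greater weight. *)
Definition lowest m P : Prop :=
  mcoeff m P != 0 /\
  forall d, (weight d <= weight m)%N -> d != m -> mcoeff d P = 0.

Lemma lowest1 : lowest mnm0 1.
Proof.
split=> [|d _ dN]; first by rewrite mcoeff1 eqxx oner_eq0.
by rewrite mcoeff1 (negPf dN).
Qed.

Lemma lowest_mcoeffM_eq0 m m' d d' P Q : lowest m P -> lowest m' Q ->
  (weight d + weight d' <= weight m + weight m')%N -> (d != m) || (d' != m') ->
  mcoeff d P * mcoeff d' Q = 0.
Proof.
move=> [_ P0] [_ Q0] dd' neq; have [dm|md] := leqP (weight d) (weight m).
  have [dE|dN] := eqVneq d m; last by rewrite P0 ?mul0r.
  move: neq dd'; rewrite dE eqxx leq_add2l => /= neq dd'.
  by rewrite Q0 ?mulr0.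
have d'm' : (weight d' < weight m')%N.
  by rewrite -(ltn_add2l (weight m)) (leq_trans _ dd')// ltn_add2r.
rewrite Q0 ?mulr0 ?(ltnW d'm')//.
by apply: contraTneq d'm' => ->; rewrite ltnn.
Qed.

Lemma lowestM m m' P Q :
  lowest m P -> lowest m' Q -> lowest (mnm_add m m') (P * Q).
Proof.
move=> Pm Qm'; split=> [|d dm dN].
  rewrite mcoeffM_uniq => [|d d' dE dN].
    by rewrite mulf_neq0 ?(Pm.1) ?(Qm'.1).
  by apply: (lowest_mcoeffM_eq0 Pm Qm'); rewrite ?dN// -!weightD dE.
apply: mcoeffM_eq0 => m1 m2 dE; apply: (lowest_mcoeffM_eq0 Pm Qm').
  by rewrite -!weightD -dE.
apply: contraNT dN; rewrite negb_or !negbK => /andP[/eqP <- /eqP <-].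
by rewrite dE.
Qed.

Lemma lowest_prod (J : {set 'I_n}) (P : 'I_n -> {mpoly D[n]}) m :
  (forall i, i \in J -> lowest (mnm1 i) (P i)) ->
  (forall i, i \notin J -> m i = 0%N) ->
  lowest m (\prod_(i < n) P i ^+ m i).
Proof.
move=> PJ mJ; rewrite {1}[m]multinomUE_id.
elim/big_rec2: _ => [|i Q d _ Qd]; first exact: lowest1.
apply: lowestM => //; have [/PJ Pi|/mJ ->] := boolP (i \in J); last first.
  by rewrite mulm0n expr0; exact: lowest1.
elim: (m i) => [|e IHe]; first by rewrite mulm0n expr0; exact: lowest1.
by rewrite mulmS exprS; exact: lowestM.
Qed.

End LowestMonomial.

(** * Separable relations for the indices in Upsilon *)

Section IdealQuotientZero.
Variables (A : comNzRingType) (I : idealr A).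

Lemma pi_ideal_eq0 (f : A) : (\pi_{ideal_quot I} f == 0) = (f \in I).
Proof. by rewrite -(rmorph0 (\pi_{ideal_quot I})) -Quotient.idealrBE subr0. Qed.

End IdealQuotientZero.

Section FreeBelow.
Variables (k : fieldType) (n : nat).
Implicit Types (f g : {mpoly k[n]}) (Q : {poly {mpoly k[n]}}).

(** Being a polynomial in the variables of index at least i, expressed by the
    vanishing of the partial derivatives in the other variables; in
    characteristic zero this is the same. *)
Definition free_below (i : nat) f : Prop :=
  forall j : 'I_n, (j < i)%N -> mderiv j f = 0.

Lemma free_belowW i f : free_below i.+1 f -> free_below i f.
Proof. by move=> fi j ji; apply: fi; rewrite ltnW. Qed.

Lemma free_belowC i c : free_below i (mpolyC n c).
Proof. by move=> j _; rewrite mderivC. Qed.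

Lemma free_below0 i : free_below i 0.
Proof. by move=> j _; rewrite mderiv0. Qed.

Lemma free_below1 i : free_below i 1.
Proof. exact: free_belowC. Qed.

Lemma free_belowX (i : nat) (j : 'I_n) :
  (i <= j)%N -> free_below i (mpolyX k (mnm1 j)).
Proof.
move=> ij l li; rewrite mderivX mnm1E.
case: eqP => [jl|]; last by rewrite scale0r.
by move: li; rewrite -jl ltnNge ij.
Qed.

Lemma free_belowD i f g :
  free_below i f -> free_below i g -> free_below i (f + g).
Proof. by move=> fi gi j ji; rewrite mderivD fi// gi// addr0. Qed.

Lemma free_belowN i f : free_below i f -> free_below i (- f).
Proof. by move=> fi j ji; rewrite mderivN fi// oppr0. Qed.

Lemma free_belowM i f g :
  free_below i f -> free_below i g -> free_below i (f * g).
Proof. by move=> fi gi j ji; rewrite mderivM fi// gi// mulr0 mul0r addr0. Qed.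

Lemma free_below_horner i (g : {mpoly k[n]}) Q :
  (forall d, free_below i Q`_d) -> free_below i g -> free_below i Q.[g].
Proof.
move=> Qi gi; rewrite horner_coef; elim/big_rec: _ => [|d f _ fi].
  exact: free_below0.
apply: free_belowD => //; apply: free_belowM; first exact: Qi.
elim: (d : nat) => [|e IHe]; first exact: free_below1.
by rewrite exprS; exact: free_belowM.
Qed.

(** If the coefficients of Q do not depend on X_i, then the partial derivative
    of Q(X_i) in X_i is Q'(X_i). *)
Lemma mderiv_horner (i : 'I_n) Q : (forall d, mderiv i Q`_d = 0) ->
  mderiv i Q.[mpolyX k (mnm1 i)] = Q^`().[mpolyX k (mnm1 i)].
Proof.
elim/poly_ind: Q => [|Q c IHQ Qi]; first by rewrite deriv0 horner0 mderiv0.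
have ci : mderiv i c = 0 by have := Qi 0%N; rewrite coefD coefMX coefC add0r.
rewrite hornerMXaddC derivMXaddC hornerD hornerMX mderivD mderivM ci addr0.
rewrite IHQ => [|d]; last by have := Qi d.+1; rewrite coefD coefMX coefC addr0.
rewrite addrC mderivX mnm1E eqxx scale1r.
have -> : mnm_sub (mnm1 i) (mnm1 i) = mnm0 :> multinom n.
  by apply/mnmP => l; rewrite mnmBE mnm0E subnn.
by rewrite mpolyX0 mulr1.
Qed.

End FreeBelow.

Section FractionsFreeBelow.
Variables (k : fieldType) (n : nat) (L : fieldType).
Local Notation A := {mpoly k[n]}.
Variable res : {rmorphism A -> L}.

(** The fractions of the images of two polynomials in the variables of index at
    least i. *)
Definition tail_frac (i : nat) : set L :=
  [set z | exists a b : A,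
    [/\ free_below i a, free_below i b, res b != 0 & z = res a / res b]].

Lemma tail_frac_gen i f : free_below i f -> tail_frac i (res f).
Proof.
move=> fi; exists f, 1; rewrite rmorph1 invr1 mulr1 oner_eq0.
by split=> //; exact: free_below1.
Qed.

Lemma tail_frac_divring i : GRing.divring_closed (mem (tail_frac i)).
Proof.
have in1 : 1 \in mem (tail_frac i).
  by rewrite inE -(rmorph1 res); apply: tail_frac_gen; exact: free_below1.
split=> // x y; rewrite !inE => -[a [b [ai bi bN0 ->]]] [c [d [ci di dN0 ->]]].
  exists (a * d - c * b), (b * d); split.
  - by apply: free_belowD; [|apply: free_belowN]; exact: free_belowM.
  - exact: free_belowM.
  - by rewrite rmorphM mulf_neq0.
  - by rewrite rmorphB !rmorphM /= -!mulNr addf_div.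
have [c0|cN0] := eqVneq (res c) 0.
  exists 0, 1; rewrite c0 mul0r invr0 mulr0 rmorph0 mul0r rmorph1 oner_eq0.
  split=> //; last exact: free_below1.
  exact: free_below0.
exists (a * d), (b * c); split; [exact: free_belowM|exact: free_belowM| |].
  by rewrite rmorphM mulf_neq0.
by rewrite !rmorphM /= invf_div mulf_div.
Qed.

Lemma clear_denominators i (q : {poly L}) : (forall d, tail_frac i q`_d) ->
  exists (b : A) (Q : {poly A}), [/\ res b != 0,
    forall d, free_below i Q`_d & map_poly res Q = res b *: q].
Proof.
(* The induction also needs b to be free of the variables below i. *)
move=> qi; suff : exists (b : A) (Q : {poly A}), [/\ res b != 0, free_below i b,
    forall d, free_below i Q`_d & map_poly res Q = res b *: q].
  by move=> [b [Q [? _ ? ?]]]; exists b, Q.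
elim/poly_ind: q qi => [_|q c IHq qi].
  exists 1, 0; rewrite rmorph1 oner_eq0 rmorph0 scaler0.
  split=> //; first exact: free_below1.
  by move=> d; rewrite coef0; exact: free_below0.
have [|b [Q [bN0 bi Qi QE]]] := IHq.
  by move=> d; have := qi d.+1; rewrite coefD coefMX coefC addr0.
have := qi 0%N; rewrite coefD coefMX coefC add0r => -[a [e [ai ei eN0 cE]]].
exists (b * e), (e *: Q * 'X + (b * a)%:P); split.
- by rewrite rmorphM mulf_neq0.
- exact: free_belowM.
- move=> [|d]; rewrite coefD coefMX coefC.
    by rewrite add0r; exact: free_belowM.
  by rewrite addr0 coefZ; exact: free_belowM.
- rewrite rmorphD rmorphM /= map_polyX map_polyC map_polyZ QE /= !rmorphM /=.
  rewrite scalerDr scalerA (mulrC (res e)) -scalerAl.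
  rewrite -[_ *: c%:P]mul_polyC -!polyCM.
  by congr (_ + polyC _); rewrite cE -mulrA [res e * _]mulrC divfK.
Qed.

Hypothesis char0 : [pchar k] =i pred0.

Lemma pchar_mpoly_target : [pchar L] =i pred0.
Proof.
move=> q; have := char0 q; rewrite !inE => <-; apply: andb_id2l => _.
by rewrite -(rmorph_nat (res \o @mpolyC n k)) fmorph_eq0.
Qed.

(** A nonzero relation of least degree for x has a nonzero derivative at x. *)
Lemma separable_relation i (Q : {poly A}) (x : L) :
  (forall d, free_below i Q`_d) -> map_poly res Q != 0 ->
  root (map_poly res Q) x ->
  exists P : {poly A}, [/\ forall d, free_below i P`_d,
    root (map_poly res P) x & ~~ root (map_poly res P)^`() x].
Proof.
elim: {Q}(size Q) {-2}Q (leqnn (size Q)) => [|s IHs] Q sQ Qi QN0 Qx.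
  move: QN0; move: sQ; rewrite leqn0 size_poly_eq0 => /eqP ->.
  by rewrite rmorph0 eqxx.
have [Q'x|Q'x] := boolP (root (map_poly res Q)^`() x); last by exists Q.
apply: (IHs (deriv Q)).
- have QN0' : Q != 0 by apply: contraNneq QN0 => ->; rewrite rmorph0.
  by rewrite -ltnS (leq_trans (lt_size_deriv QN0')).
- move=> d; rewrite coef_deriv; move: (Qi d.+1) => Qd1.
  elim: {2}d.+1 => [|e IHe].
    by rewrite mulr0n; exact: free_below0.
  by rewrite mulrS; exact: free_belowD.
- rewrite -deriv_map; apply: contraTneq Qx => Q'0.
  suff sQ1 : (size (map_poly res Q) <= 1)%N.
    by move: QN0; rewrite (size1_polyC sQ1) rootC polyC_eq0.
  apply/leq_sizeP => -[//|j] _; have /polyP/(_ j) := Q'0.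
  rewrite coef_deriv coef0 -mulr_natr => /eqP; rewrite mulf_eq0.
  by have /pcharf0P -> := pchar_mpoly_target; rewrite orbF => /eqP.
- by rewrite -deriv_map.
Qed.

End FractionsFreeBelow.

Section AlgebraicRelation.
Variables (k : fieldType) (n : nat) (p : prime_idealr {mpoly k[n]}).
Local Notation A := {mpoly k[n]}.
Local Notation L := {fraction {ideal_quot p}}.
Local Notation res := (@residue k n p).

HB.instance Definition _ := GRing.RMorphism.copy res
  (@FracField.tofrac {ideal_quot p} \o \pi_{ideal_quot p}).

Lemma residue_eq0 f : (res f == 0) = (f \in p).
Proof. by rewrite /residue tofrac_eq0 pi_ideal_eq0. Qed.

Lemma tail_field_frac i : tail_field p i `<=` tail_frac res i.
Proof.
apply: smallest_sub; first exact: tail_frac_divring.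
move=> z [[c _ <-]|[j ij <-]]; apply: (@tail_frac_gen _ _ _ res).
  exact: free_belowC.
exact: free_belowX.
Qed.

Hypothesis char0 : [pchar k] =i pred0.

Local Notation phi := (\pi_{ideal_quot p} : {rmorphism A -> {ideal_quot p}}).

(** For i in Upsilon, some polynomial in the variables of index at least i
    vanishes modulo p and has the class of X_i as a simple root when viewed as a
    polynomial in X_i. *)
Lemma UpsilonP (i : 'I_n) : i \in Upsilon p ->
  exists2 f : A, free_below i f & f \in p /\ mderiv i f \notin p.
Proof.
rewrite inE => /asboolP /(_ (res (mpolyX k (mnm1 i)))) [|q [qN0 qi qx]].
  by apply: sub_gen_smallest; right; exists i => //=.
have [b [Q [bN0 Qi QE]]] :=
  clear_denominators (fun d => tail_field_frac (qi d)).
have QresN0 : map_poly res Q != 0 by rewrite QE scaler_eq0 negb_or bN0.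
have Qx : root (map_poly res Q) (res (mpolyX k (mnm1 i))) by rewrite QE rootZ.
have [P [Pi Px P'x]] := separable_relation char0 Qi QresN0 Qx.
exists P.[mpolyX k (mnm1 i)].
  apply: free_below_horner; last exact: free_belowX.
  by move=> d; exact: free_belowW.
rewrite mderiv_horner => [|d]; last by exact: Pi.
rewrite -!residue_eq0 -!horner_map -deriv_map.
by split; [exact: Px|exact: P'x].
Qed.

Lemma lowest_taylor_Upsilon (i : 'I_n) : i \in Upsilon p ->
  exists f : A, lowest (mnm1 i) (taylor phi f).
Proof.
move=> /UpsilonP[f fi [fp f'p]]; exists f; split.
  apply/eqP => /(mcoeff_taylor_eq0 _ char0)/eqP.
  by rewrite mderivmU1m pi_ideal_eq0 (negPf f'p).
move=> d; rewrite weight1 => /leq_weight1[-> _|[j -> ji] dN].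
  by apply/(mcoeff_taylor_eq0 _ char0)/eqP; rewrite mderivm0m pi_ideal_eq0.
apply/(mcoeff_taylor_eq0 _ char0); rewrite mderivmU1m fi ?rmorph0//.
by rewrite ltn_neqAle ji andbT; apply: contra dN => /eqP/val_inj ->.
Qed.

End AlgebraicRelation.

(** * Chains of submodules of the localization of A/I *)

Section TaylorChain.
Variables (k : fieldType) (n : nat) (p : prime_idealr {mpoly k[n]}).
Variable I : idealr {mpoly k[n]}.
Local Notation A := {mpoly k[n]}.
Local Notation M := {ideal_quot I}.
Variables (D : idomainType) (phi : {rmorphism A -> D}).
Hypothesis phi_eq0 : forall f, (phi f == 0) = (f \in p).
Local Notation T := (taylor phi).
Implicit Types (t : seq (multinom n)) (f g : A).

(** The Taylor expansion of f has no monomial dividing a monomial of t. *)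
Definition vanishing t f : Prop := forall m d, m \in t -> mpoly.lem d m ->
  mcoeff d (T f) = 0.

Lemma vanishing0 t : vanishing t 0.
Proof. by move=> m d _ _; rewrite rmorph0 mcoeff0. Qed.

Lemma vanishingD t f g : vanishing t f -> vanishing t g -> vanishing t (f + g).
Proof.
move=> ft gt m d mt dm; rewrite rmorphD /= mcoeffD.
by rewrite (ft _ _ mt dm) (gt _ _ mt dm) addr0.
Qed.

Lemma vanishingM t f g : vanishing t g -> vanishing t (f * g).
Proof.
move=> gt m d mt dm; rewrite rmorphM /=; apply: mcoeffM_eq0 => d1 d2 dE.
rewrite (gt m d2) ?mulr0//; apply: (lepm_trans _ dm).
by rewrite dE; exact: lem_addl.
Qed.

(** The submodule of (A/I)_p generated by the f such that [vanishing t f]. *)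
Definition loc_vanishing t : {pred loc_mod p M} := fun x =>
  `[< exists f s, vanishing t f /\ x = loc_frac (\pi_M f) s >].

Lemma quot_scaler_pi f g : f *: (\pi_M g : M) = \pi_M (f * g).
Proof. by rewrite rmorphM. Qed.

Fact loc_vanishing_submod t : GRing.submod_closed (loc_vanishing t).
Proof.
split.
  apply/asboolP; exists 0, (denom1 p); split; first exact: vanishing0.
  by rewrite rmorph0 loc_frac0.
move=> a x y /asboolP[f [s [ft ->]]] /asboolP[g [r [gt ->]]]; apply/asboolP.
case: (loc_ringP a) => {}a u.
exists (den r * (a * f) + den (denom_mul u s) * g).
exists (denom_mul (denom_mul u s) r).
split; first by apply: vanishingD; do !apply: vanishingM.
by rewrite [_ *: _]loc_scaleE loc_fracD !quot_scaler_pi -rmorphD.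
Qed.

HB.instance Definition _ t := GRing.isSubmodClosed.Build _ _ (loc_vanishing t)
  (GRing.submod_closed_semi (loc_vanishing_submod t)).

Lemma loc_vanishing_sub t t' : {subset t <= t'} ->
  {subset loc_vanishing t' <= loc_vanishing t}.
Proof.
move=> tt' x /asboolP[f [s [ft' ->]]]; apply/asboolP; exists f, s; split=> //.
by move=> m d /tt'; exact: ft'.
Qed.

(** The class of f is not in [loc_vanishing t']: otherwise T (v f) would have no
    term Y^m for some v outside p, although its coefficient of Y^m is the
    product of phi v, which is nonzero, and of the coefficient of Y^m in T f. *)
Lemma loc_vanishing_proper t t' m f : vanishing t f -> m \in t' ->
  lowest m (T f) -> {in I, forall g, vanishing t' g} ->
  ~ {subset loc_vanishing t <= loc_vanishing t'}.
Proof.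
move=> ft mt' fm It' /(_ (loc_frac (\pi_M f) (denom1 p))) sub.
have {sub} /sub : loc_frac (\pi_M f) (denom1 p) \in loc_vanishing t.
  by apply/asboolP; exists f, (denom1 p).
move=> /asboolP[g [s [gt' /loc_fracP[u uE]]]].
have : den u * (den s * f) - den u * (1 * g) \in I.
  by rewrite Quotient.idealrBE; apply/eqP; rewrite -!quot_scaler_pi uE.
move=> /It' /(_ m m mt' (lepm_refl m)).
have /(_ m m mt' (lepm_refl m)) gm := vanishingM (den u * 1) gt'.
rewrite !mulrA rmorphB mcoeffB /= gm subr0 rmorphM /= -[X in mcoeff X _]add0m.
rewrite mcoeffM_uniq => [/eqP|d1 d2 mE d1N0].
  rewrite mulf_eq0 (negPf fm.1) orbF mcoeff0_taylor phi_eq0.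
  by rewrite prime_idealrM (negPf (denP u)) (negPf (denP s)).
move: mE; rewrite add0m => mE.
rewrite (fm.2 d2) ?mulr0 ?mE ?leq_weight ?lem_addl//.
by apply: contra d1N0 => /eqP E; apply/eqP/(@addIm _ d2); rewrite -E add0m.
Qed.

(** The chain is indexed increasingly, so that its i-th term is attached to the
    first [size t - i] monomials of t, once t is sorted by weight. *)
Lemma module_length_ge (R : realType) t (F : multinom n -> A) : uniq t ->
  {in t, forall m, lowest m (T (F m))} -> {in I, forall g, vanishing t g} ->
  ((size t)%:R%:E <= module_length R (loc_ring p) (loc_mod p M))%E.
Proof.
move=> ut tF It; pose leqw (m1 m2 : multinom n) := (weight m1 <= weight m2)%N.
wlog st : t ut tF It / sorted leqw t => [wlog_st|].
  rewrite -(size_sort leqw); apply: wlog_st.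
  - by rewrite sort_uniq.
  - by move=> m; rewrite mem_sort => /tF.
  - by move=> g /It gt m d; rewrite mem_sort => /gt; exact.
  - by apply: sort_sorted => m1 m2; exact: leq_total.
apply: ereal_sup_ubound; exists (size t) => //.
exists (fun i => GRing.SubmodClosed.clone _ _
  (loc_vanishing (take (size t - i) t)) _) => i it.
rewrite subnS; set j := (size t - i)%N; have j0 : (0 < j)%N by rewrite subn_gt0.
have jt : (j.-1 < size t)%N by rewrite prednK// leq_subr.
split.
  apply: loc_vanishing_sub => m; apply: mem_subseq.
  by rewrite -[take j.-1 t](take_takel t (leq_pred j)); exact: take_subseq.
have leqw_trans : transitive leqw by move=> ? ? ?; exact: leq_trans.
have leqw_refl : reflexive leqw by move=> ?; exact: leqnn.
pose m := nth mnm0 t j.-1.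
have mt : m \in t by exact: mem_nth.
apply: (@loc_vanishing_proper _ _ m (F m)).
- move=> m' d m'j dm'.
  have m't : m' \in t by exact: mem_take m'j.
  move: m'j; rewrite in_take// => m'j.
  have m'm : (weight m' <= weight m)%N.
    rewrite -(nth_index mnm0 m't).
    apply: (sorted_leq_nth leqw_trans leqw_refl mnm0 st) => //.
      by rewrite inE index_mem.
    exact: ltnW.
  have [_] := tF _ mt; apply; first by rewrite (leq_trans (leq_weight dm')).
  apply: contraTneq m'j => dm; rewrite dm in dm'.
  by rewrite (lem_weight_eq dm' m'm) index_uniq// ltnn.
- rewrite -[j in take j]prednK// (take_nth mnm0)// mem_rcons inE eqxx//.
- exact: tF.
- by move=> g /It gt m' d /mem_take; exact: gt.
Qed.

End TaylorChain.

(** * Covering by unit cubes *)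

Section UnitCubes.
Variable R : realType.
Local Notation tupleR m := (m.-tuple (measurableTypeR R)).

(** The half-open cube of side 1 whose lower corner is c. *)
Definition unit_cube m (c : m.-tuple nat) : set (tupleR m) :=
  [set t | forall i, (tnth c i)%:R <= (tnth t i : R) < (tnth c i).+1%:R].

Lemma unit_cube_cons m (e : nat) (c : m.-tuple nat) :
  unit_cube [tuple of e :: c] =
  @tuple_uncons R m @^-1` (`[e%:R, e.+1%:R[%classic `*` unit_cube c).
Proof.
have uncons x (t : tupleR m) : tuple_uncons [tuple of x :: t] = (x, t).
  exact: (tuple_consK (x, t)).
apply/seteqP; split=> t; case/tupleP: t => x t; rewrite /preimage /mkset uncons.
  move=> tc; split=> [|i]; first by have := tc ord0; rewrite /= in_itv.
  by have := tc (lift ord0 i); rewrite !tnthS.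
move=> [xe tc] i; case: (unliftP ord0 i) => [j ->|->].
  by rewrite !tnthS; exact: tc.
by move: xe; rewrite /= in_itv.
Qed.

Lemma measurable_unit_cube m (c : m.-tuple nat) : measurable (unit_cube c).
Proof.
elim: m c => [|m IHm] c.
  rewrite (_ : unit_cube c = setT)//; apply/seteqP; split=> // t _ i.
  by case: i.
case/tupleP: c => e c; rewrite unit_cube_cons -[X in measurable X]setTI.
apply: measurable_tuple_uncons => //; exact: measurableX.
Qed.

Lemma lebesgue_unit_cube m (c : m.-tuple nat) :
  lebesgue_tuple R m (unit_cube c) = 1%E.
Proof.
elim: m c => [|m IHm] c.
  rewrite /= diracE mem_set// => i; by case: i.
case/tupleP: c => e c; rewrite unit_cube_cons /= /lebesgue_cons /pushforward.
rewrite -comp_preimage (_ : _ \o _ = id); last first.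
  by apply/funext => x /=; exact: tuple_consK.
rewrite preimage_id product_measure1E//; last exact: measurable_unit_cube.
rewrite IHm mule1.
transitivity (lebesgue_measure (`[e%:R, e.+1%:R[%classic : set R)) => //.
rewrite lebesgue_measure_itv /= lte_fin ltr_nat ltnSn.
by rewrite -EFinB -natrB// subSnn.
Qed.

Lemma mu_ext_unit_cubes m (s : seq (m.-tuple nat)) (S : set (tupleR m)) :
  (forall t, S t -> exists2 c, c \in s & unit_cube c t) ->
  (mu_ext (lebesgue_tuple R m) S <= (size s)%:R%:E)%E.
Proof.
move=> Ss; pose c0 := [tuple of nseq m 0%N].
pose F i := unit_cube (nth c0 s i).
have mF i : measurable (F i) by exact: measurable_unit_cube.
have SF : S `<=` \big[setU/set0]_(i < size s) F i.
  move=> t /Ss[c cs ct]; rewrite -bigcup_mkord; exists (index c s) => /=.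
    by rewrite index_mem.
  by rewrite /F nth_index.
apply: (le_trans (le_mu_ext _ SF)); rewrite measurable_mu_extE; last first.
  exact: bigsetU_measurable.
apply: (le_trans (Boole_inequality _ _)) => //.
rewrite (eq_bigr (fun=> 1%E)) => [|i _]; last exact: lebesgue_unit_cube.
by rewrite sumEFin sumr_const card_ord.
Qed.

Lemma coord_volume_le n (Delta : set 'rV[R]_n) (J : {set 'I_n})
    (s : seq (multinom n)) : lower_saturated Delta ->
  (forall gamma : multinom n, Delta (nat_point R gamma) ->
    (forall j, j \notin J -> gamma j = 0%N) -> gamma \in s) ->
  (coord_volume J (Delta `&` coord_subspace J) <= (size s)%:R%:E)%E.
Proof.
move=> [Dge0 _ Dlow] Ds.
pose c (gamma : multinom n) := [tuple gamma (enum_val i) | i < #|J|].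
rewrite -(size_map c); apply: mu_ext_unit_cubes => _ [xi [Dxi xiJ] <-].
(* The lower corner of the cube containing xi. *)
pose gamma : multinom n := Multinom [tuple Num.truncn (xi 0 i) | i < n].
exists (c gamma).
  apply: map_f; apply: Ds => [|j jJ]; last first.
    by rewrite multinomE tnth_mktuple xiJ// truncn0.
  apply: (Dlow _ Dxi) => i; rewrite mxE ler0n /= multinomE tnth_mktuple.
  by rewrite truncn_le; exact: (Dge0 _ Dxi).
move=> i; rewrite !tnth_mktuple multinomE tnth_mktuple; apply: truncn_itv.
exact: (Dge0 _ Dxi).
Qed.

End UnitCubes.

(** * The bound on the length *)

Theorem proposition0p1 (R : realType) (k : fieldType) (n : nat)
    (p : prime_idealr {mpoly k[n]}) (Delta : set 'rV[R]_n)
    (I : idealr {mpoly k[n]}) :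
  [pchar k] =i pred0 ->
  (0 < n)%N ->
  lower_saturated Delta ->
  minimal_prime I p ->
  (forall gamma : multinom n, Delta (nat_point R gamma) ->
     forall f, f \in I -> mderivm gamma f \in p) ->
  (coord_volume (Upsilon p) (Delta `&` coord_subspace (Upsilon p)) <=
   module_length R (loc_ring p) (loc_mod p {ideal_quot I}))%E.
Proof.
move=> char0 _ Dlow _ DI.
pose phi := \pi_{ideal_quot p} : {rmorphism {mpoly k[n]} -> {ideal_quot p}}.
have phi_eq0 f : (phi f == 0) = (f \in p) by exact: pi_ideal_eq0.
have /choice[G GP] (i : 'I_n) : exists f : {mpoly k[n]},
    i \in Upsilon p -> lowest (mnm1 i) (taylor phi f).
  have [/(lowest_taylor_Upsilon char0)[f]|_] := boolP (i \in Upsilon p).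
    by exists f.
  by exists 0.
pose SigmaU := [set m : multinom n | Delta (nat_point R m) /\
  forall j, j \notin Upsilon p -> m j = 0%N].
have lengthS (s : seq (multinom n)) : uniq s -> [set` s] `<=` SigmaU ->
    ((size s)%:R%:E <=
     module_length R (loc_ring p) (loc_mod p {ideal_quot I}))%E.
  move=> us sS; pose F (m : multinom n) := \prod_(i < n) G i ^+ m i.
  apply: (@module_length_ge _ _ _ _ _ _ phi_eq0 _ _ F) => //
    [m ms|f fI m d ms dm].
    rewrite rmorph_prod /=; under eq_bigr do rewrite rmorphXn /=.
    by apply: (lowest_prod (J := Upsilon p)) => //; have [] := sS m ms.
  apply/(mcoeff_taylor_eq0 phi char0)/eqP; rewrite phi_eq0; apply: DI fI.
  have [Dm _] := sS m ms; have [_ _ /(_ _ Dm)] := Dlow; apply=> i.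
  by rewrite !mxE ler0n ler_nat (mnm_lepP dm).
have [/finite_seqP[s sE]|Sinf] := pselect (finite_set SigmaU).
  apply: (le_trans _ (lengthS _ (undup_uniq s) _)).
    apply: coord_volume_le => // m Dm mU; rewrite mem_undup.
    by have : SigmaU m by []; rewrite sE.
  by rewrite sE => m /=; rewrite mem_undup.
(* When SigmaU is infinite, it has finite subsets of arbitrary size. *)
suff -> : module_length R (loc_ring p) (loc_mod p {ideal_quot I}) = +oo%E.
  exact: leey.
apply/eqyP => x x0; have [B BS xB] := infinite_set_fset (Num.truncn x).+1 Sinf.
apply: (le_trans _ (lengthS _ (finmap.fset_uniq B) BS)).
rewrite lee_fin; apply: (@le_trans _ _ (Num.truncn x).+1%:R).
  by rewrite ltW// truncnS_gt.
by rewrite ler_nat.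
Qed.
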